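(* Let $Y$ be a real topological vector space, $A\subseteq Y$ and $k\in Y\setminus\{0\}$. (a) $\operatorname{cl}A$ is $k$-directionally closed, i.e., $\operatorname{cl}_k(\operatorname{cl}A)=\operatorname{cl}A$. (b) $\operatorname{cl}_kA\subseteq\operatorname{cl}A$. (c) If $A$ is closed, then it is $k$-directionally closed, i.e., $\operatorname{cl}_kA=A$. (d) $\operatorname{cl}_kA$ is closed if and only if $\operatorname{cl}_kA=\operatorname{cl}A$. (e) $\operatorname{cl}A-\mathbb{R}_{>}k\subseteq A$ holds if and only if $k\in-0^+A$ and $\operatorname{cl}_kA=\operatorname{cl}A$.
   Context: $\mathbb{R}_{+}=\{x\in\mathbb{R}:x\ge 0\}$, $\mathbb{R}_{>}=\{x\in\mathbb{R}:x>0\}$, $\mathbb{R}_{>}k=\{tk:t\in\mathbb{R}_{>}\}$. The recession cone of $A$ is $0^+A=\{u\in Y: A+\mathbb{R}_{+}u\subseteq A\}$, and $-0^+A=\{-u:u\in 0^+A\}$. $\operatorname{cl}A$ is the topological closure. The $k$-directional closure $\operatorname{cl}_k(A)$ is the set of all $y\in Y$ such that for each $\lambda\in\mathbb{R}_{>}$ there exists $t\in\mathbb{R}_{+}$ with $t<\lambda$ and $y-tk\in A$; $A$ is $k$-directionally closed if $A=\operatorname{cl}_k(A)$. *)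

(* Defs.v *)
From mathcomp Require Import all_boot all_order all_algebra.
From mathcomp Require Import all_classical all_reals all_analysis.

Set Implicit Arguments.
Unset Strict Implicit.
Unset Printing Implicit Defensive.

Import Order.TTheory GRing.Theory Num.Theory.
Import numFieldNormedType.Exports.

Local Open Scope classical_set_scope.
Local Open Scope ring_scope.

(* Real topological vector spaces are [topologicalLmodType R] with [R] a
   [realType]: addition and scaling are jointly continuous, and neither the
   Hausdorff property nor local convexity (as in [tvsType]) is assumed. *)

Definition set_add (V : zmodType) (A B : set V) : set V :=
  [set a + b | a in A & b in B].

Definition set_sub (V : zmodType) (A B : set V) : set V :=
  [set a - b | a in A & b in B].

Definition set_opp (V : zmodType) (A : set V) : set V :=
  [set - a | a in A].

Section DirectionalClosure.
Context {R : realType} {Y : lmodType R}.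
Implicit Types (A : set Y) (k u : Y).

Definition nneg_ray u : set Y := [set t *: u | t in [set t : R | 0 <= t]].

Definition pos_ray u : set Y := [set t *: u | t in [set t : R | 0 < t]].

Definition recession_cone A : set Y :=
  [set u | set_add A (nneg_ray u) `<=` A].

Definition dir_closure k A : set Y :=
  [set y | forall lambda : R, 0 < lambda ->
     exists t : R, [/\ 0 <= t, t < lambda & A (y - t *: k)]].

Definition dir_closed k A : Prop := A = dir_closure k A.

End DirectionalClosure.

(* Main.v *)
Require Import Defs.
From mathcomp Require Import all_boot all_order all_algebra.
From mathcomp Require Import all_classical all_reals all_analysis.

Import Order.TTheory GRing.Theory Num.Theory.
Import numFieldNormedType.Exports.

Local Open Scope classical_set_scope.
Local Open Scope ring_scope.

Section DirectionalClosureTopology.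
Context {R : realType} {Y : topologicalLmodType R}.
Implicit Types (A : set Y) (k y : Y).

(** Everything rests on the sandwich [A] ⊆ [dir_closure k A] ⊆ [closure A]. The left inclusion takes
    t = 0; the right one holds because y - tk tends to y as t tends to 0 ([cvg_subZ]). Parts (a)-(d)
    then follow from properties of the closure operator alone. For (e), points of [closure A] are
    linked to [A] by arbitrarily short moves along -k, which the recession direction -k extends to
    any longer move. *)

Lemma subset_dir_closure k A : A `<=` dir_closure k A.
Proof.
move=> y Ay l l0; exists 0; split => //.
by rewrite scale0r subr0.
Qed.

(** The only place where the compatibility of the topology with the linear structure enters, through
    continuity of scaling and of subtraction. *)
Lemma cvg_subZ y k : (fun t : R => y - t *: k) @ (0 : R) --> y.
Proof.
have cZ : (fun t : R => t *: k) @ (0 : R) --> 0 *: k.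
  exact: (cvg_comp2 (cvg_id (F := nbhs (0 : R^o))) (cvg_cst k)
    (@scale_continuous R Y (_, _))).
rewrite -[X in _ --> X](subr0 y) -(scale0r k).
apply: (@continuous2_cvg R Y Y Y _ _ (fun=> y) (fun t => t *: k)
  (fun a b => a - b) y (0 *: k)).
- exact: (@sub_continuous Y (_, _)).
- exact: cvg_cst.
- exact: cZ.
Qed.

Lemma dir_closure_subset_closure k A : dir_closure k A `<=` closure A.
Proof.
move=> y yA B /(cvg_subZ y k) /nbhs_ballP[e /= e0 eB].
(* The radius [e] of a ball around 0 whose points t all have y - tk in [B] serves as the bound
   [lambda]. *)
have [t [t0 te Ayt]] := yA e e0.
exists (y - t *: k); split => //.
by apply: eB; rewrite /ball /= sub0r normrN ger0_norm.
Qed.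

Lemma closed_dir_closed k A : closed A -> dir_closed k A.
Proof.
move=> cA; apply/seteqP; split; first exact: subset_dir_closure.
by rewrite [X in _ `<=` X](closure_id A).1 //; exact: dir_closure_subset_closure.
Qed.

Lemma closed_dir_closureP k A :
  closed (dir_closure k A) <-> dir_closure k A = closure A.
Proof.
split=> [cA|->]; last exact: closed_closure.
apply/seteqP; split; first exact: dir_closure_subset_closure.
(* Closedness turns the right side into the closure of [dir_closure k A], so monotonicity of closure
   suffices. *)
rewrite [X in _ `<=` X](closure_id _).1 //.
by apply: closureS; exact: subset_dir_closure.
Qed.

Lemma closure_sub_pos_rayP k A :
  set_sub (closure A) (pos_ray k) `<=` A <->
  k \in set_opp (recession_cone A) /\ dir_closure k A = closure A.
Proof.
rewrite in_setE; split=> [sA|[[u uA uk] clA] _ [y yA [_ [t t0 <-] <-]]].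
  have subA y t : closure A y -> 0 < t -> A (y - t *: k).
    by move=> yA t0; apply: sA; exists y => //; exists (t *: k) => //; exists t.
  split.
    exists (- k); last by rewrite opprK.
    move=> _ [y yA [_ [t t0 <-] <-]]; rewrite scalerN.
    move: t0; rewrite /= le_eqVlt => /predU1P[<-|t0].
      by rewrite scale0r subr0.
    by apply: subA => //; exact: subset_closure.
  apply/seteqP; split; first exact: dir_closure_subset_closure.
  (* Any t strictly between 0 and [l] would do, since every positive t sends y into [A]. *)
  move=> y yA l l0; exists (l / 2); split.
  - by rewrite divr_ge0 // ltW.
  - by rewrite ltr_pdivrMr // ltr_pMr // ltr1n.
  - by apply: subA => //; rewrite divr_gt0.
(* With [t] itself as the bound, some s < t has y - sk in [A]; the remaining move by t - s > 0 is
   along u = -k, a recession direction. *)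
move: yA; rewrite -clA => /(_ t t0)[s [s0 st yA]].
apply: uA; exists (y - s *: k) => //.
exists ((t - s) *: u); first by exists (t - s) => //=; rewrite subr_ge0 ltW.
by rewrite -uk scalerBl !scalerN !opprK -addrA [s *: u + _]addrC subrK.
Qed.

End DirectionalClosureTopology.

Theorem proposition7 (R : realType) (Y : topologicalLmodType R) (A : set Y)
    (k : Y) (hk : k != 0) :
  [/\ (* (a) *) dir_closed k (closure A),
      (* (b) *) dir_closure k A `<=` closure A,
      (* (c) *) closed A -> dir_closed k A,
      (* (d) *) closed (dir_closure k A) <-> dir_closure k A = closure A &
      (* (e) *) set_sub (closure A) (pos_ray k) `<=` A <->
                k \in set_opp (recession_cone A) /\
                dir_closure k A = closure A].
Proof.
split.
- exact/closed_dir_closed/closed_closure.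
- exact: dir_closure_subset_closure.
- exact: closed_dir_closed.
- exact: closed_dir_closureP.
- exact: closure_sub_pos_rayP.
Qed.
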